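(* Let $T$ be an h-inductive theory in a language $L$ and let $x$ be a finite tuple of variables. The positive type space $S_x(T)$ has the Baire property for the spectral topology; that is, for every countable family $(U_i)_{i<\omega}$ of spectrally open and spectrally dense subsets of $S_x(T)$, the intersection $\bigcap_{i<\omega}U_i$ is dense in $S_x(T)$ for the spectral topology.
   Context: $L$ is a many-sorted first-order language containing two $0$-ary relation symbols $\top$ (true) and $\bot$ (false), interpreted in the obvious way. The notation $\phi(x)$ means that the free variables of $\phi$ are among the finite tuple $x$. A positive formula is a finitary formula built from atomic formulas using only finite conjunctions, finite disjunctions and existential quantifications; $L^+$ is the set of positive formulas. An h-inductive sentence is a finite conjunction of sentences of the form $\forall x\,(\phi(x)\Rightarrow\psi(x))$ with $\phi,\psi$ positive; an h-inductive theory is a set of h-inductive sentences. A positive type of $T$ in variables $x$ is a set $p$ of positive formulas $\phi(x)$ such that $T\cup p(x)$ is consistent and $p$ is maximal with this property. $S_x(T)$ is the set of all such positive types. For $\phi(x)\in L^+$ put $[\phi]=\{p\in S_x(T):\phi\in p\}$. The spectral topology on $S_x(T)$ has the sets $[\phi]$, $\phi(x)\in L^+$, as a basis of open sets. *)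

(* Defs.v *)
From HB Require Import structures.
From mathcomp Require Import all_boot.
From mathcomp Require Import all_classical topology.

Set Implicit Arguments.
Unset Strict Implicit.
Unset Printing Implicit Defensive.

Local Open Scope classical_set_scope.

(* Function and relation symbols are typed by the list of sorts of their
   arguments; no finiteness or countability is assumed.  The two 0-ary relation
   symbols true and false are not listed in [rsym]: they are the constructors
   [PTop] and [PBot] of [pformula]. *)
Record language := Language {
  lsort : Type;
  fsym : Type;
  fdom : fsym -> seq lsort;
  fcod : fsym -> lsort;
  rsym : Type;
  rdom : rsym -> seq lsort
}.

Arguments fdom {l}.
Arguments fcod {l}.
Arguments rdom {l}.

(* A finite tuple x of variables is represented by the list of the sorts of its
   members; [var x s] is the type of the positions of x carrying sort s. *)
Inductive var (S : Type) : seq S -> S -> Type :=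
| VHead s x : var (s :: x) s
| VTail t x s : var x s -> var (t :: x) s.

Inductive term (L : language) (x : seq (lsort L)) : lsort L -> Type :=
| TVar s : var x s -> term x s
| TApp (f : fsym L) : terms x (fdom f) -> term x (fcod f)
with terms (L : language) (x : seq (lsort L)) : seq (lsort L) -> Type :=
| TNil : terms x [::]
| TCons s y : term x s -> terms x y -> terms x (s :: y).

(* [pformula L x] is the type of the positive formulas phi(x).  The quantifier
   binds the head of the extended tuple (de Bruijn style). *)
Inductive pformula (L : language) : seq (lsort L) -> Type :=
| PTop x : pformula x
| PBot x : pformula x
| PEq x s : term x s -> term x s -> pformula x
| PRel x (r : rsym L) : terms x (rdom r) -> pformula x
| PAnd x : pformula x -> pformula x -> pformula x
| POr x : pformula x -> pformula x -> pformula x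
| PEx x s : pformula (s :: x) -> pformula x.

Arguments pformula : clear implicits.
Arguments PTop {L x}.
Arguments PBot {L x}.

(* [HAll phi psi] is the sentence: for all x, phi(x) implies psi(x). *)
Inductive hsentence (L : language) : Type :=
| HAll x : pformula L x -> pformula L x -> hsentence L
| HAnd : hsentence L -> hsentence L -> hsentence L.

Definition htheory (L : language) := set (hsentence L).

Fixpoint tuple_in (S : Type) (M : S -> Type) (x : seq S) : Type :=
  if x is s :: y then (M s * tuple_in M y)%type else unit.

(* Sorts are allowed to be empty; that the sort s is nonempty is expressed by
   the h-inductive sentence [@HAll L [::] PTop (@PEx L [::] s PTop)]. *)
Record structure (L : language) := Structure {
  carrier :> lsort L -> Type;
  finterp : forall f : fsym L, tuple_in carrier (fdom f) -> carrier (fcod f);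
  rinterp : forall r : rsym L, tuple_in carrier (rdom r) -> Prop
}.

Fixpoint veval (S : Type) (M : S -> Type) (x : seq S) (s : S) (v : var x s) :
    tuple_in M x -> M s :=
  match v with
  | VHead _ _ => fun a => a.1
  | VTail _ _ _ w => fun a => veval w a.2
  end.

Fixpoint teval (L : language) (M : structure L) (x : seq (lsort L))
    (a : tuple_in M x) (s : lsort L) (t : term x s) : M s :=
  match t with
  | TVar _ v => veval v a
  | TApp f ts => @finterp L M f (tseval a ts)
  end
with tseval (L : language) (M : structure L) (x : seq (lsort L))
    (a : tuple_in M x) (y : seq (lsort L)) (ts : terms x y) : tuple_in M y :=
  match ts with
  | TNil => tt
  | TCons _ _ t us => (teval a t, tseval a us)
  end.

Fixpoint psat (L : language) (M : structure L) (x : seq (lsort L))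
    (phi : pformula L x) : tuple_in M x -> Prop :=
  match phi with
  | PTop _ => fun=> True
  | PBot _ => fun=> False
  | PEq _ _ t u => fun a => teval a t = teval a u
  | PRel _ r ts => fun a => @rinterp L M r (tseval a ts)
  | PAnd _ f g => fun a => psat f a /\ psat g a
  | POr _ f g => fun a => psat f a \/ psat g a
  | PEx _ s f => fun a => exists b : M s, psat f (b, a)
  end.

Fixpoint hsat (L : language) (M : structure L) (sigma : hsentence L) : Prop :=
  match sigma with
  | HAll x phi psi => forall a : tuple_in M x, psat phi a -> psat psi a
  | HAnd sigma1 sigma2 => hsat M sigma1 /\ hsat M sigma2
  end.

Definition models (L : language) (M : structure L) (T : htheory L) : Prop :=
  forall sigma, T sigma -> hsat M sigma.

(* Consistency of T together with p(x): some model of T contains a tuple, named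
   by x, that satisfies all of p.  It is not mere finite satisfiability. *)
Definition consistent (L : language) (T : htheory L) (x : seq (lsort L))
    (p : set (pformula L x)) : Prop :=
  exists (M : structure L) (a : tuple_in M x),
    models M T /\ forall phi, p phi -> psat phi a.

Definition is_ptype (L : language) (T : htheory L) (x : seq (lsort L))
    (p : set (pformula L x)) : Prop :=
  consistent T p /\
  forall q : set (pformula L x), consistent T q -> p `<=` q -> q = p.

Definition ptype_space (L : language) (T : htheory L) (x : seq (lsort L)) :=
  {p : set (pformula L x) | is_ptype T p}.

Definition ptype_basic (L : language) (T : htheory L) (x : seq (lsort L))
    (phi : pformula L x) : set (ptype_space T x) :=
  [set p | sval p phi].

Lemma ptype_real (L : language) (T : htheory L) (x : seq (lsort L))
    (p : set (pformula L x)) : is_ptype T p ->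
  exists (M : structure L) (a : tuple_in M x),
    models M T /\ forall phi, p phi <-> psat phi a.
Proof.
move=> [[M [a [MT pa]]] pmax]; exists M, a; split=> // phi; split=> [|aphi].
  exact: pa.
have <- : [set psi | psat psi a] = p by apply: pmax => //; exists M, a.
exact: aphi.
Qed.

Lemma ptype_basicT (L : language) (T : htheory L) (x : seq (lsort L)) :
  \bigcup_(phi in [set: pformula L x]) @ptype_basic L T x phi = setT.
Proof.
apply/seteqP; split=> // -[p pT] _; exists PTop => //=.
by have [M [a [_ pE]]] := ptype_real pT; apply/pE.
Qed.

Lemma ptype_basicI (L : language) (T : htheory L) (x : seq (lsort L))
    (phi psi : pformula L x) :
  ptype_basic (T := T) (PAnd phi psi) =
  ptype_basic phi `&` ptype_basic psi.
Proof.
apply/seteqP; split=> -[p pT] /=;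
  have [M [a [_ pE]]] := ptype_real pT; rewrite /ptype_basic /=.
  by move=> /pE[? ?]; split; apply/pE.
by move=> [/pE ? /pE ?]; apply/pE.
Qed.

HB.instance Definition _ (L : language) (x : seq (lsort L)) :=
  gen_eqMixin (pformula L x).
HB.instance Definition _ (L : language) (x : seq (lsort L)) :=
  gen_choiceMixin (pformula L x).
HB.instance Definition _ (L : language) (x : seq (lsort L)) :=
  isPointed.Build (pformula L x) PTop.

HB.instance Definition _ (L : language) (T : htheory L) (x : seq (lsort L)) :=
  gen_eqMixin (ptype_space T x).
HB.instance Definition _ (L : language) (T : htheory L) (x : seq (lsort L)) :=
  gen_choiceMixin (ptype_space T x).

Lemma ptype_basic_join (L : language) (T : htheory L) (x : seq (lsort L))
    (phi psi : pformula L x) (p : ptype_space T x) :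
  [set: pformula L x] phi -> [set: pformula L x] psi ->
  ptype_basic phi p -> ptype_basic psi p ->
  exists chi, [/\ [set: pformula L x] chi, ptype_basic chi p &
    ptype_basic chi `<=` ptype_basic phi `&` @ptype_basic L T x psi].
Proof.
by move=> _ _ pphi ppsi; exists (PAnd phi psi); rewrite ptype_basicI; split.
Qed.

(* The spectral topology: the sets [phi], phi positive, form a basis. *)
HB.instance Definition _ (L : language) (T : htheory L) (x : seq (lsort L)) :=
  isBaseTopological.Build (ptype_space T x)
    (@ptype_basicT L T x) (@ptype_basic_join L T x).

(* Main.v *)
Require Import Defs.
From mathcomp Require Import all_boot all_classical topology.

Local Open Scope classical_set_scope.

Set Implicit Arguments.
Unset Strict Implicit.

(** The proof is the one for compact spaces, but carried out with basic open
    sets.  Starting from a nonempty basic open set [phi_0] inside the given open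
    set O, openness and density of U_n give a nonempty [phi_(n+1)] contained in
    both [phi_n] and U_n.  A point of all the [phi_n] lies in O and in every
    U_n, so everything rests on one fact: a decreasing sequence of nonempty
    basic open sets has a common point (ptype_basic_bigcap).

    For that, realize a point of [phi_n] by a tuple a_n in a model M_n of T.
    The positive formulas that hold of a_n for almost all n are together
    consistent with T (consistent_near), they include every phi_n, and a
    consistent set of positive formulas extends to a maximal one, that is, to a
    positive type (ptype_extends).  The extension is needed because a limit of
    positive types need not itself be maximal; a larger type is just as good,
    since membership in [phi_n] only asks that phi_n belong to it.

    Both the consistency of the limit and the chain condition in Zorn's lemma
    are instances of compactness for h-inductive theories, proved with
    ultraproducts.  Since a sort may be empty in some of the models, an element
    of the ultraproduct is the germ of a section that need only be defined
    almost everywhere. *)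

(** * Ultraproducts of structures with possibly empty sorts *)

Lemma choice_dep (I : Type) (Y : I -> Type) (P : forall i, Y i -> Prop) :
  (forall i, exists y, P i y) -> exists f : forall i, Y i, forall i, P i (f i).
Proof.
by move=> h; exists (fun i => projT1 (cid (h i))) => i; case: cid.
Qed.

Section Ultraproduct.
Context (L : language) (I : Type) (F : set_system I) {FU : UltraFilter F}.
Context (M : I -> structure L).

(** Total sections would not do: a sort that is empty in a single M i would
    become empty in the ultraproduct. *)
Definition psection (s : lsort L) := forall i, option (M i s).

Definition section_class s (f : psection s) : set (psection s) :=
  [set g | F [set i | f i = g i]].

Definition ucarrier (s : lsort L) : Type :=
  {C : set (psection s) |
    exists2 f, F [set i | isSome (f i)] & C = section_class f}.

(** An element of the ultraproduct is compared with the elements of the factors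
    through a chosen section in its class; any two choices agree F-almost
    everywhere, so nothing that holds F-almost everywhere depends on it. *)
Definition urep s (u : ucarrier s) : psection s := s2val (cid2 (svalP u)).

Lemma urep_defined s (u : ucarrier s) : F [set i | isSome (urep u i)].
Proof. by rewrite /urep; case: cid2. Qed.

Lemma urep_inj s (u v : ucarrier s) : F [set i | urep u i = urep v i] -> u = v.
Proof.
case: u v => [C hC] [D hD]; rewrite /urep /=.
case: cid2 => f ? Cf; case: cid2 => g ? Dg /= fg.
have E : C = D.
  rewrite Cf Dg; apply/seteqP; split=> h; move: fg; apply: filterS2 => i /= ->.
    by [].
  by [].
move: hC hD {Cf Dg}; rewrite E => hC hD.
by congr exist; exact: Prop_irrelevance.
Qed.

Lemma urep_exists s (f : psection s) : F [set i | isSome (f i)] ->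
  exists u : ucarrier s, F [set i | urep u i = f i].
Proof.
move=> df; exists (exist _ (section_class f) (ex_intro2 _ _ f df erefl)).
rewrite /urep /=; case: cid2 => g ? /= E.
have : section_class f f by apply: filterS filterT.
by rewrite E.
Qed.

Fixpoint utuple (i : I) (x : seq (lsort L)) :
    tuple_in ucarrier x -> option (tuple_in (M i) x) :=
  match x with
  | [::] => fun=> Some tt
  | s :: y => fun a =>
      if urep a.1 i is Some b then
        if utuple i a.2 is Some c then Some (b, c) else None
      else None
  end.

Lemma utuple_defined x (a : tuple_in ucarrier x) :
  F [set i | isSome (utuple i a)].
Proof.
elim: x a => [|s x IH] a /=; first by apply: filterS filterT.
move: (urep_defined a.1) (IH a.2); apply: filterS2 => i /=.
by case: (urep a.1 i) => // b _; case: (utuple i a.2).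
Qed.

Lemma utuple_exists x (a : forall i, tuple_in (M i) x) :
  exists b : tuple_in ucarrier x, F [set i | utuple i b = Some (a i)].
Proof.
elim: x a => [|s x IH] a.
  by exists tt; apply: filterS filterT => i /= _ /=; case: (a i).
have [b Fb] := IH (fun i => (a i).2).
have [|u Fu] := @urep_exists s (fun i => Some (a i).1).
  by apply: filterS filterT.
exists (u, b); move: Fu Fb; apply: filterS2 => i /= -> ->.
by case: (a i).
Qed.

Lemma ufun_exists (f : Defs.fsym L) (a : tuple_in ucarrier (fdom f)) :
  exists u : ucarrier (fcod f),
    F [set i | urep u i = omap (@finterp L (M i) f) (utuple i a)].
Proof.
apply: urep_exists; apply: filterS (utuple_defined a) => i /=.
by case: (utuple i a).
Qed.

(** The if in the interpretation of relations is decisive only on the F-small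
    set where some argument is undefined. *)
Definition ultraproduct : structure L :=
  @Structure L ucarrier
    (fun f a => projT1 (cid (ufun_exists a)))
    (fun r a => F [set i | if utuple i a is Some b then rinterp b else False]).

Scheme term_mind := Induction for term Sort Prop
  with terms_mind := Induction for terms Sort Prop.

Lemma urep_veval x s (v : var x s) (a : tuple_in ucarrier x) i b :
  utuple i a = Some b -> urep (veval v a) i = Some (veval v b).
Proof.
elim: v a b => {x s} [s x|t x s v IH] a b /=;
  case: (urep a.1 i) => // c; case E: (utuple i a.2) => [d|] // [<-] //=.
exact: IH.
Qed.

Lemma urep_tseval x y (ts : terms x y) (a : tuple_in ultraproduct x) :
  F [set i | forall b, utuple i a = Some b ->
               utuple i (tseval a ts) = Some (tseval b ts)].
Proof.
pose P s (t : term x s) := F [set i | forall b, utuple i a = Some b ->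
  urep (@teval L ultraproduct x a s t) i = Some (teval b t)].
apply: (@terms_mind L x P (fun y ts =>
  F [set i | forall b, utuple i a = Some b ->
  @utuple i y (@tseval L ultraproduct x a y ts) = Some (tseval b ts)])).
- by rewrite /P => s v; apply: filterS filterT => i /= _ b; exact: urep_veval.
- rewrite /P => f us IH /=; case: cid => u /= Fu.
  by move: Fu IH; apply: filterS2 => i /= -> H b /H ->.
- by apply: filterS filterT.
- rewrite /P => s z t Ft us Fus; move: Ft Fus.
  by apply: filterS2 => i /= H1 H2 b /= E; rewrite (H1 _ E) (H2 _ E).
Qed.

Lemma urep_teval x s (t : term x s) (a : tuple_in ultraproduct x) :
  F [set i | forall b, utuple i a = Some b ->
               urep (teval a t) i = Some (teval b t)].
Proof.
apply: filterS (urep_tseval (TCons t (TNil x)) a) => i H b /H /=.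
by case: (urep _ i) => // c [->].
Qed.

(** Łoś's theorem.  Each connective reduces to a closure property of F:
    conjunction to binary intersections, falsity to properness, and the
    existential quantifier to choosing witnesses index by index, the section
    being undefined where there is none.  Disjunction alone uses that F is an
    ultrafilter and not just a filter. *)
Lemma ultraproduct_psat x (phi : pformula L x) (a : tuple_in ultraproduct x) :
  psat phi a <-> F [set i | exists2 b, utuple i a = Some b & psat phi b].
Proof.
have defined y (c : tuple_in ultraproduct y) :
    F [set i | exists b, utuple i c = Some b].
  apply: filterS (utuple_defined c) => i /=.
  by case: (utuple i c) => // b _; exists b.
elim: phi a => {x}
  [x|x|x s t u|x r ts|x f IHf g IHg|x f IHf g IHg|x s f IHf] a /=.
- by split=> // _; apply: filterS (defined _ a) => i /= [b ?]; exists b.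
- by split=> // /filter_ex[i []].
- split=> [tu|].
    move: (defined _ a) (urep_teval t a) (urep_teval u a).
    apply: filterS3 => i /= [b ab] /(_ _ ab) Et /(_ _ ab) Eu; exists b => //.
    by move: Eu; rewrite -tu Et => -[].
  move=> H; apply: urep_inj; move: H (urep_teval t a) (urep_teval u a).
  by apply: filterS3 => i /= [b ab tu] /(_ _ ab) -> /(_ _ ab) ->; rewrite tu.
- split=> H.
    move: H (defined _ a) (urep_tseval ts a).
    by apply: filterS3 => i /= H [b ab] /(_ _ ab) E; exists b;
      rewrite ?E // in H *.
  move: H (urep_tseval ts a).
  by apply: filterS2 => i /= [b ab ?] /(_ _ ab) ->.
- split=> [[/IHf Hf /IHg Hg]|H].
    move: Hf Hg; apply: filterS2 => i /= [b ab fb] [c].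
    by rewrite ab => -[<-] gb; exists b.
  by split; [apply/IHf|apply/IHg]; apply: filterS H => i /= [b ab []]; exists b.
- split=> [[/IHf|/IHg]|H].
  + by apply: filterS => i /= [b ab ?]; exists b => //; left.
  + by apply: filterS => i /= [b ab ?]; exists b => //; right.
  + have [Ff|Ff] := in_ultra_setVsetC
      [set i | exists2 b, utuple i a = Some b & psat f b] FU.
      by left; apply/IHf.
    right; apply/IHg; move: H Ff; apply: filterS2 => i /= [b ab [fb|gb]] nf.
      by case: nf; exists b.
    by exists b.
- split=> [[u /IHf]|H].
    apply: filterS => i /= [b /=]; case: (urep u i) => // c.
    by case: (utuple i a) => // d [<-] fcd; exists d => //; exists c.
  pose P i (c : M i s) := exists2 b : tuple_in (M i) x,
    utuple i a = Some b & psat f ((c, b) : tuple_in (M i) (s :: x)).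
  have [g gP] : exists g : psection s,
      forall i, (exists c, P i c) -> exists2 c, g i = Some c & P i c.
    apply: (@choice_dep _ _ (fun i o =>
      (exists c, P i c) -> exists2 c, o = Some c & P i c)).
    move=> i; case: (pselect (exists c, P i c)) => [[c Pc]|nP].
      by exists (Some c) => _; exists c.
    by exists None.
  have Fg : F [set i | exists2 c, g i = Some c & P i c].
    by apply: filterS H => i /= [b ab [c fcb]]; apply: gP; exists c, b.
  have [|u Fu] := @urep_exists s g.
    by apply: filterS Fg => i /= [c ->].
  exists u; apply/IHf; move: Fg Fu.
  apply: filterS2 => i /= [c gc [b ab fcb]] /= ->.
  by rewrite gc ab; exists (c, b).
Qed.

(** If every factor satisfies an implication between positive formulas, the
    indices where its premise holds are among those where its conclusion does,
    and F is closed under supersets. *)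
Lemma ultraproduct_models (T : htheory L) :
  (forall i, models (M i) T) -> models ultraproduct T.
Proof.
move=> MT sigma Tsigma.
have : forall i, hsat (M i) sigma by move=> i; exact: MT.
elim: sigma {Tsigma} => [x phi psi|s1 IH1 s2 IH2] H /=.
  move=> a /ultraproduct_psat Fphi; apply/ultraproduct_psat.
  by apply: filterS Fphi => i /= [b ab /H]; exists b.
by split; [apply: IH1|apply: IH2] => i; case: (H i).
Qed.

End Ultraproduct.

(** * Compactness and extension to positive types *)

(** Compactness in filter form: the ultraproduct along any ultrafilter finer
    than F realizes the limit set.  Using a filter, and not finite subsets,
    serves sequences and chains alike. *)
Lemma consistent_near (L : language) (T : htheory L) (x : seq (lsort L))
    (I : Type) (F : set_system I) (M : I -> structure L)
    (a : forall i, tuple_in (M i) x) :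
  ProperFilter F -> (forall i, models (M i) T) ->
  consistent T [set phi | F [set i | psat phi (a i)]].
Proof.
move=> /ultraFilterLemma[G [GU FG]] MT.
have [b Gb] := utuple_exists (FU := GU) a.
exists (ultraproduct (F := G) M), b; split; first exact: ultraproduct_models.
move=> phi /= /FG Gphi; apply/ultraproduct_psat; move: Gb Gphi.
by apply: filterS2 => i /= ? ?; exists (a i).
Qed.

(** Compactness along the filter of final segments of the chain C: a formula of
    the union belongs to all sufficiently large members. *)
Lemma consistent_bigcup (L : language) (T : htheory L) (x : seq (lsort L))
    (C : set (set (pformula L x))) :
  C !=set0 -> total_on C subset -> C `<=` @consistent L T x ->
  consistent T (\bigcup_(q in C) q).
Proof.
move=> C0 Ctot Ccons.
have /choice_dep[M /choice_dep[a Ma]] : forall q : {q | @consistent L T x q},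
  exists (M : structure L) (a : tuple_in M x),
    models M T /\ forall phi, sval q phi -> psat phi a by case.
pose F := filter_from C (fun q => [set r : {q | @consistent L T x q} |
                                     q `<=` sval r]).
have FF : ProperFilter F.
  apply: filter_from_proper; last first.
    by move=> q Cq; exists (exist _ q (Ccons q Cq)) => /=.
  apply: filter_from_filter => // q r Cq Cr.
  have [qr|rq] := Ctot q r Cq Cr; [exists r|exists q] => //= t tS.
    by split=> //; exact: subset_trans tS.
  by split=> //; exact: subset_trans tS.
have [|N [b [NT bP]]] := @consistent_near L T x _ F M a FF.
  by move=> q; have [] := Ma q.
exists N, b; split=> // phi [q Cq qphi]; apply: bP; exists q => // r qr /=.
by have [_] := Ma r; apply; apply: qr.
Qed.

(** Zorn's lemma is applied to the sets A for which p `|` A is consistent, so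
    that the empty chain is bounded by the consistency of p itself. *)
Lemma ptype_extends (L : language) (T : htheory L) (x : seq (lsort L))
    (p : set (pformula L x)) :
  consistent T p -> exists q : ptype_space T x, p `<=` sval q.
Proof.
move=> pT.
have [|A [AT Amax]] := @Zorn_bigcup _ [set A | consistent T (p `|` A)].
  move=> C CT Ctot /=; have [->|C0] := eqVneq C set0.
    by rewrite bigcup_set0 setU0.
  have -> : p `|` \bigcup_(A in C) A
          = \bigcup_(B in [set p `|` A | A in C]) B.
    rewrite bigcup_image; apply/seteqP; split=> phi.
      case/set0P: C0 => A CA [pphi|[B CB Bphi]]; first by exists A => //; left.
      by exists B => //; right.
    by case=> A CA [pphi|Aphi]; [left|right; exists A].
  apply: consistent_bigcup.
  - by case/set0P: C0 => A CA; exists (p `|` A), A.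
  - move=> _ _ [A CA <-] [B CB <-].
    by have [AB|BA] := Ctot A B CA CB; [left|right]; exact: setUS.
  - by move=> _ [A CA <-]; exact: CT.
have qA q : consistent T q -> p `|` A `<=` q -> q = A.
  move=> qT pAq; apply: contrapT => nqA; apply: (Amax q); last first.
    by rewrite /= (setUidr (subset_trans (@subsetUl _ p A) pAq)).
  rewrite properEneq; split; first by apply/eqP => Aq; apply: nqA.
  exact: subset_trans (@subsetUr _ p A) pAq.
have pAE : p `|` A = A by exact: qA.
rewrite /= pAE in AT qA.
by exists (exist _ A (conj AT qA)); rewrite /= -pAE; exact: subsetUl.
Qed.

(** * The Baire property *)

Lemma ptype_basic_open (L : language) (T : htheory L) (x : seq (lsort L))
    (phi : pformula L x) : open (@ptype_basic L T x phi).
Proof. by exists [set phi] => //; rewrite bigcup_set1. Qed.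

Lemma ptype_open_basic (L : language) (T : htheory L) (x : seq (lsort L))
    (U : set (ptype_space T x)) p :
  open U -> U p -> exists2 phi, sval p phi & ptype_basic phi `<=` U.
Proof.
by move=> [D _ <-] [phi Dphi ?]; exists phi => // q qphi; exists phi.
Qed.

(** A countable form of compactness of the spectral topology: a realization of
    a point of [phi_m] satisfies phi_n for all n <= m, so phi_n is true almost
    everywhere along the sequence of realizations. *)
Lemma ptype_basic_bigcap (L : language) (T : htheory L) (x : seq (lsort L))
    (phi : nat -> pformula L x) :
  (forall n, @ptype_basic L T x (phi n.+1) `<=` ptype_basic (phi n)) ->
  (forall n, @ptype_basic L T x (phi n) !=set0) ->
  \bigcap_n @ptype_basic L T x (phi n) !=set0.
Proof.
move=> dec /choice[p pphi].
have /choice_dep[M /choice_dep[a Ma]] := fun n => ptype_real (svalP (p n)).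
have [|q qP] := @ptype_extends L T x
    [set psi | \forall n \near \oo, psat psi (a n)].
  by apply: consistent_near => n; have [] := Ma n.
exists q => n _; apply: qP; exists n => // m /= nm.
have [_ aE] := Ma m; apply/aE.
suff : ptype_basic (phi n) (p m) by [].
move: (pphi m); rewrite -(subnK nm); elim: (m - n)%N (p _) => // k IH r.
by move=> /dec /IH.
Qed.

Theorem proposition1p8 (L : language) (T : htheory L) (x : seq (lsort L))
    (U : nat -> set (ptype_space T x)) :
  (forall i : nat, open (U i) /\ dense (U i)) ->
  dense (\bigcap_(i in [set: nat]) U i).
Proof.
move=> oU O [p0 Op0] oO.
have [phi0 p0phi0 phi0O] := ptype_open_basic oO Op0.
pose basic := @ptype_basic L T x.
have shrink (i : nat) phi : exists psi,
    basic phi !=set0 -> basic psi !=set0 /\ basic psi `<=` basic phi `&` U i.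
  have [phiN|] := pselect (basic phi !=set0); last by exists phi.
  have [oUi dUi] := oU i.
  have [p phiUp] := dUi _ phiN (ptype_basic_open T phi).
  have oI := openI (ptype_basic_open T phi) oUi.
  have [psi ppsi psiU] := ptype_open_basic oI phiUp.
  by exists psi; split=> //; exists p.
have next i := choice (shrink i).
pose fix phi n := if n is m.+1 then projT1 (next m) (phi m) else phi0.
have phiN n : basic (phi n) !=set0.
  by elim: n => [|n IH] /=; [exists p0|have [] := projT2 (next n) _ IH].
have phiS n : basic (phi n.+1) `<=` basic (phi n) `&` U n.
  by have [] := projT2 (next n) _ (phiN n).
have [|q qphi] := @ptype_basic_bigcap L T x phi _ phiN.
  by move=> n p /phiS[].
exists q; split; first exact/phi0O/(qphi 0).
by move=> i _; have [] := phiS i q (qphi i.+1 I).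
Qed.
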